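(* Let $h:\Delta^n\to\mathbb{R}$ be strictly convex and consider the FTRL learning dynamic with regularizer $h$. Let $h^*(\mathbf{q}):=\max_{\mathbf{x}\in\Delta^n}\{\langle\mathbf{q},\mathbf{x}\rangle-h(\mathbf{x})\}$. Then for any $\mathbf{x}^*\in\Delta^n$, the learning operator with shift $\mathbf{x}^*$ is finitely lossless via the storage function $L(\mathbf{q})=h^*(\mathbf{q})-\langle\mathbf{q},\mathbf{x}^*\rangle+h(\mathbf{x}^* )$. In particular, for every action $j$ the learning operator with shift $\mathbf{e}_j$ is finitely lossless, so every FTRL dynamic is a finitely lossless learning dynamic.
   Context: $\Delta^n=\{\mathbf{x}\in\mathbb{R}^n: x_j\ge 0,\ \sum_j x_j=1\}$; $\mathbf{e}_j$ is the $j$-th standard basis vector. A learning dynamic over $n$ actions is specified by a conversion function $f:\mathbb{R}^n\to\Delta^n$: given an initial state $\mathbf{q}^0\in\mathbb{R}^n$ and an input function $\mathbf{p}:[0,\infty)\to\mathbb{R}^n$ square integrable on bounded intervals, the state is $\mathbf{q}(t)=\mathbf{q}^0+\int_0^t\mathbf{p}(\tau)\,d\tau$ and the strategy is $\mathbf{x}(t)=f(\mathbf{q}(t))$. The FTRL dynamic with strictly convex regularizer $h:\Delta^n\to\mathbb{R}$ has conversion function $f(\mathbf{q})=\arg\max_{\mathbf{x}\in\Delta^n}\{\langle\mathbf{q},\mathbf{x}\rangle-h(\mathbf{x})\}$. The learning operator with shift $\mathbf{x}^*\in\mathbb{R}^n$ has state $\mathbf{q}$, input $\mathbf{p}$, output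 $\mathbf{x}-\mathbf{x}^*$; it is lossless via a storage function $L:\mathbb{R}^n\to\mathbb{R}$ if for every $\mathbf{q}^0$, every $\mathbf{p}$ and every $t\ge0$, $L(\mathbf{q}(t))= L(\mathbf{q}^0)+\int_0^t\langle\mathbf{p}(\tau),\mathbf{x}(\tau)-\mathbf{x}^*\rangle\,d\tau$, and finitely lossless if it is lossless via a storage function bounded from below. A learning dynamic is finitely lossless if for every action $j$ its learning operator with shift $\mathbf{e}_j$ is finitely lossless. *)

(* Defs.v *)
From HB Require Import structures.
From mathcomp Require Import all_boot all_order all_algebra.
From mathcomp Require Import all_classical all_reals all_analysis.
Set Implicit Arguments. Unset Strict Implicit. Unset Printing Implicit Defensive.
Import Order.TTheory GRing.Theory Num.Theory.
Local Open Scope classical_set_scope.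
Local Open Scope ring_scope.

Section LearningDefs.
Variable R : realType.
Variable n : nat.

Definition vec := 'I_n -> R.

Definition dotp (u v : vec) : R := \sum_(j < n) u j * v j.

Definition in_simplex (x : vec) : Prop :=
  (forall j, 0 <= x j) /\ \sum_(j < n) x j = 1.

Definition basis_vec (j : 'I_n) : vec := fun i => (i == j)%:R.

(* Strict convexity of h on Delta^n (h is only evaluated on the simplex). *)
Definition strictly_convex_on_simplex (h : vec -> R) : Prop :=
  forall x y : vec, in_simplex x -> in_simplex y -> x <> y ->
  forall t : R, 0 < t < 1 ->
    h (fun i => t * x i + (1 - t) * y i) < t * h x + (1 - t) * h y.

Definition is_ftrl_argmax (h : vec -> R) (q x : vec) : Prop :=
  in_simplex x /\
  forall y, in_simplex y -> dotp q y - h y <= dotp q x - h x.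

Definition is_ftrl_conversion (h : vec -> R) (f : vec -> vec) : Prop :=
  forall q, is_ftrl_argmax h q (f q).

Definition hstar (h : vec -> R) (q : vec) : R :=
  sup [set dotp q x - h x | x in in_simplex].

Definition admissible_input (p : 'I_n -> R -> R) : Prop :=
  forall j, forall t : R, 0 <= t ->
    measurable_fun `[0, t] (p j) /\
    (lebesgue_measure).-integrable `[0, t] (fun s => ((p j s) ^+ 2)%:E).

Definition state (q0 : vec) (p : 'I_n -> R -> R) (t : R) : vec :=
  fun j => q0 j + Rintegral lebesgue_measure `[0, t] (p j).

Definition lossless_via (f : vec -> vec) (xs : vec) (L : vec -> R) : Prop :=
  forall (q0 : vec) (p : 'I_n -> R -> R), admissible_input p ->
  forall t : R, 0 <= t ->
    L (state q0 p t) =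
    L q0 + Rintegral lebesgue_measure `[0, t]
             (fun s => \sum_(j < n) p j s * (f (state q0 p s) j - xs j)).

Definition bounded_below (L : vec -> R) : Prop :=
  exists c : R, forall q, c <= L q.

Definition finitely_lossless_via (f : vec -> vec) (xs : vec) (L : vec -> R) : Prop :=
  bounded_below L /\ lossless_via f xs L.

Definition finitely_lossless (f : vec -> vec) (xs : vec) : Prop :=
  exists L : vec -> R, finitely_lossless_via f xs L.

(* A learning dynamic (given by its conversion function) is finitely lossless. *)
Definition finitely_lossless_dynamic (f : vec -> vec) : Prop :=
  forall j : 'I_n, finitely_lossless f (basis_vec j).

End LearningDefs.

(* Main.v *)
(** The FTRL strategy [f q] is a subgradient of [hstar h] at [q], so
    [L q = hstar h q - dotp q xs + h xs] satisfies
    [L q + <q' - q, f q - xs> <= L q']; it is nonnegative by Fenchel-Young.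
    Along an absolutely continuous state [q(t)] with derivative [p], [L (q t)]
    is dominated by the absolutely continuous [A t = \int \sum_j |p_j|] and at
    almost every [t] it is supported from below by the function
    [y |-> L (q t) + <q y - q t, f (q t) - xs>], whose derivative at [t] is
    [<p t, f (q t) - xs>]. Forward difference quotients of [L (q t)] are above
    those of the support and backward ones below; Fatou's lemma applied to both
    pinches the integral of this derivative to the increment of [L (q t)].

    The strategy [f] need not be continuous ([h] is not assumed lower
    semicontinuous), so differentiability of [hstar h] is not available. *)
Require Import Defs.
From HB Require Import structures.
From mathcomp Require Import all_boot all_order all_algebra.
From mathcomp Require Import all_classical all_reals all_analysis.
From mathcomp Require Import measurable_realfun ring lra.
Set Implicit Arguments. Unset Strict Implicit. Unset Printing Implicit Defensive.
Import Order.TTheory GRing.Theory Num.Theory.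
Import numFieldNormedType.Exports.
Local Open Scope classical_set_scope.
Local Open Scope ring_scope.
Import HBNNSimple.

(** * Integrals of almost everywhere equal functions *)

(* No measurability of [f] is assumed: its integral is defined as the supremum
   of the integrals of the simple functions below it. *)
Lemma ge0_ae_eq_integral_nonmeas d (T : measurableType d) (R : realType)
    (mu : {measure set T -> \bar R}) (D : set T) (f g : T -> \bar R) :
  measurable D -> measurable_fun D g ->
  (forall x, D x -> 0 <= f x)%E -> (forall x, D x -> 0 <= g x)%E ->
  ae_eq mu D f g -> (\int[mu]_(x in D) f x = \int[mu]_(x in D) g x)%E.
Proof.
move=> mD mg f0 g0 [N [mN muN subN]].
have fgN x : D x -> ~ N x -> f x = g x.
  by move=> Dx; apply: contra_notP => fgx; apply: subN => /= /(_ Dx).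
apply/eqP; rewrite eq_le; apply/andP; split.
  (* A simple function below [f] on [D] lies below [g] off the null set [N], and both are
     measurable, so monotonicity of the integral applies. *)
  rewrite ge0_integralE//; apply: ge_ereal_sup => /= _ [h hf <-].
  rewrite -integralT_nnsfun (integral_mkcond D).
  apply: ae_ge0_le_integral => //.
  - by move=> x _; rewrite lee_fin.
  - exact/measurable_EFinP.
  - by move=> x _; apply: erestrict_ge0.
  - by apply/(measurable_restrictT _ _).1.
  exists N; split => // x /=; apply: contra_notP => Nx _.
  have := hf x; rewrite !patchE; case: ifPn => // /set_mem Dx.
  by rewrite fgN.
(* Conversely, dropping [N] preserves the integral of the measurable [g], and a simple function
   below [f] on [D] minus [N] is below [f] on [D] because [f] is nonnegative. *)
rewrite (@ge0_negligible_integral _ _ _ mu D N)//.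
rewrite (@eq_integral _ _ _ _ _ f); last first.
  by move=> x /set_mem[Dx Nx]; rewrite fgN.
rewrite !ge0_integralE//; last by move=> x [/f0].
apply: le_ereal_sup => /= _ [h hf <-]; exists h => // x.
apply: le_trans (hf x) _; rewrite !patchE.
case: ifPn => [/set_mem[Dx _]|_]; first by rewrite mem_set.
by case: ifPn => // /set_mem /f0.
Qed.

(** Meant for the integrand [P], which involves the possibly discontinuous strategy and is not known
    to be measurable. *)
Lemma ae_eq_integral_nonmeas d (T : measurableType d) (R : realType)
    (mu : {measure set T -> \bar R}) (D : set T) (f g : T -> \bar R) :
  measurable D -> measurable_fun D g ->
  ae_eq mu D f g -> (\int[mu]_(x in D) f x = \int[mu]_(x in D) g x)%E.
Proof.
move=> mD mg /ae_eq_funeposneg[fgp fgn].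
rewrite integralE [in RHS]integralE; congr (_ - _)%E.
- by apply: ge0_ae_eq_integral_nonmeas => //; exact: measurable_funepos.
- by apply: ge0_ae_eq_integral_nonmeas => //; exact: measurable_funeneg.
Qed.

(** * Difference quotients and their integrals *)

Definition difference_quotient (R : realType) (F : R -> R) (e x : R) : R :=
  e^-1 * (F (e + x) - F x).

Lemma cvg_difference_quotient (R : realType) (F : R -> R) (e : R^nat)
    (x l : R) :
  e @ \oo --> 0 -> (forall n, e n != 0) -> is_derive x 1 F l ->
  difference_quotient F (e n) x @[n --> \oo] --> l.
Proof.
move=> e0 en0 dF.
have : h^-1 *: ((F \o shift x) (h *: 1) - F x) @[h --> 0^'] --> l.
  have [/cvg_ex[/= l' Fl'] <-] := dF.
  rewrite /derive; set u := (X in lim X); rewrite -/u in Fl' *.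
  by rewrite (cvg_lim _ Fl').
have e0' : e @ \oo --> 0^'.
  move=> A /= /e0 nA.
  apply: (filterS _ (nA : \forall n \near \oo, e n != 0 -> A (e n))) => n.
  by apply; exact: en0.
move=> /(cvg_comp _ _ e0'); apply: cvg_trans; apply: near_eq_cvg.
near=> n; rewrite /= /difference_quotient.
by rewrite [(_ *: 1)%R]mulr1.
Unshelve. all: by end_near. Qed.

Lemma continuous_difference_quotient (R : realType) (F : R -> R) (e : R) :
  continuous F -> continuous (difference_quotient F e).
Proof.
move=> cF x; apply: cvgM; first exact: cvg_cst.
apply: cvgB; last exact: cF.
apply: continuous_cvg; first exact: cF.
by apply: cvgD; [exact: cvg_cst|exact: cvg_id].
Qed.

(** For a primitive [Phi] of [F], the quotient of [F] is the derivative of the quotient of [Phi].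
    Its integral is thus the difference of the quotients of [Phi] at [d] and [c], which tend to
    [F d] and [F c]. *)
Lemma cvg_integral_difference_quotient (R : realType) (F : R -> R) (c d : R)
    (e : R^nat) :
  c < d -> continuous F -> e @ \oo --> 0 -> (forall n, e n != 0) ->
  (\int[lebesgue_measure]_(x in `[c, d]) difference_quotient F (e n) x)
    @[n --> \oo] --> F d - F c.
Proof.
move=> cd cF e0 en0.
(* Starting at [c - 2] keeps [e n + x] where [Phi] is differentiable, for [x >= c] and
   [|e n| < 1]. *)
pose Phi x := \int[lebesgue_measure]_(t in `[c - 2, x]) F t.
have dPhi x : c - 2 < x -> is_derive x 1 Phi (F x).
  move=> cx; have [] := @continuous_FTC1_closed R F (c - 2) x (x + 1).
  - by rewrite ltrDl.
  - apply: continuous_compact_integrable; first exact: segment_compact.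
    exact: continuous_subspaceT.
  - exact: cx.
  - exact: cF.
  by move=> dF dFE; apply: DeriveDef => //; rewrite -derive1E.
have c2c : c - 2 < c by rewrite ltrBlDr ltrDl.
have Phi_cd := cvgB (cvg_difference_quotient e0 en0 (dPhi d (lt_trans c2c cd)))
             (cvg_difference_quotient e0 en0 (dPhi c c2c)).
apply: (cvg_trans _ (Phi_cd _)); apply: near_eq_cvg; near=> n.
have en1 : `|e n| < 1.
  by near: n; have /cvgr0Pnorm_lt := e0; exact.
pose G := difference_quotient Phi (e n).
have dG x : c <= x -> is_derive x 1 G (difference_quotient F (e n) x).
  move=> cx.
  have c2ex : c - 2 < e n + x.
    rewrite ltrBlDr; apply: le_lt_trans cx _; rewrite addrAC ltrDr.
    by move: en1; rewrite ltr_norml => /andP[+ _]; lra.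
  have dsh : is_derive x 1 (fun y => e n + y) 1.
    rewrite -[X in is_derive _ _ _ X]add0r.
    exact: (is_deriveD (is_derive_cst (e n) x 1) (is_derive_id x 1)).
  have dPhi1 : is_derive x 1 (Phi \o (fun y => e n + y)) (F (e n + x)).
    by have := is_derive1_comp (dPhi _ c2ex) dsh; rewrite mulr1.
  exact: (is_deriveZ (e n)^-1 (is_deriveB dPhi1 (dPhi _ (lt_le_trans c2c cx)))).
have cG x : c <= x -> {for x, continuous G}.
  move=> /dG[+ _] => /derivable1_diffP.
  exact: differentiable_continuous.
rewrite /Rintegral (@continuous_FTC2 R _ G c d)//.
- by apply: continuous_subspaceT; exact: continuous_difference_quotient.
- split.
  + by move=> x /[!in_itv]/= /andP[/ltW /dG[]].
  + by apply: cvg_at_right_filter; exact: cG.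
  + by apply: cvg_at_left_filter; apply: cG; exact: ltW.
- move=> x /[!in_itv]/= /andP[/ltW /dG[_ <-] _].
  by rewrite derive1E.
Unshelve. all: by end_near. Qed.

(** * Fatou's lemma on forward and backward quotients *)

Lemma cvg_le_limn_einf (R : realType) (u v : (\bar R)^nat) (l : \bar R) :
  v @ \oo --> l -> (forall n, v n <= u n)%E -> (l <= limn_einf u)%E.
Proof.
move=> vl vu; rewrite -(cvg_limn_einf_sup vl).1 !limn_einf_lim.
apply: lee_lim; [exact: is_cvg_einfs|exact: is_cvg_einfs|].
apply: nearW => n; apply: le_ereal_inf_tmp => _ [k nk <-] /=.
by apply: le_trans (vu k); apply: ereal_inf_lbound; exists k.
Qed.

(* [s = 1] uses forward and [s = -1] backward difference quotients; [U] is the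
   lower limit of the nonnegative quotients of [A + s F]. *)
Lemma fatou_difference_quotient (R : realType) (F A g P : R -> R) (c d s : R) :
  let mu := @lebesgue_measure R in
  s ^+ 2 = 1 -> c < d -> continuous A -> continuous F ->
  (forall x y, x <= y -> `|F y - F x| <= A y - A x) ->
  {ae mu, forall x : R, is_derive x 1 A (g x)} ->
  {ae mu, forall x : R, `[c, d]%classic x -> exists psi : R -> R,
    [/\ is_derive x 1 psi (P x), psi x = F x & forall y, psi y <= F y]} ->
  exists U : R -> \bar R,
    [/\ measurable_fun `[c, d] U, forall x, (0 <= U x)%E,
        (\int[mu]_(x in `[c, d]) U x <= (A d - A c + s * (F d - F c))%:E)%E
      & {ae mu, forall x, `[c, d]%classic x -> ((g x + s * P x)%:E <= U x)%E}].
Proof.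
move=> mu s2 cd cA cF FA dA dF.
have sE : (s == 1) || (s == - 1) by rewrite -sqrf_eq1 s2.
pose e n : R := s * n.+1%:R^-1.
have e0 : e @ \oo --> (0 : R).
  by rewrite -(mulr0 s); apply: cvgM; [exact: cvg_cst|exact: cvg_harmonic].
have s0 : s != 0 by rewrite -sqrf_eq0 s2 oner_eq0.
have en0 n : e n != 0 by rewrite mulf_neq0// invr_eq0 pnatr_eq0.
pose u n x := difference_quotient A (e n) x + s * difference_quotient F (e n) x.
have ss : s * s = 1 by rewrite -expr2.
have seV n : s * (e n)^-1 = n.+1%:R.
  by rewrite /e invfM invrK mulrA divff// mul1r.
have u0 n x : 0 <= u n x.
  (* As [s] is the sign of the step [e n], [s * (A (e n + x) - A x)] is the nonnegative increment of
     [A] between the two points, which dominates that of [F]. *)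
  have -> : u n x = n.+1%:R * (s * (A (e n + x) - A x) + (F (e n + x) - F x)).
    rewrite -(seV n) /u /difference_quotient.
    set a := A _ - A x; set b := F _ - F x; set v := (e n)^-1.
    by rewrite -[in LHS](mul1r (v * a)) -ss; ring.
  rewrite mulr_ge0//; have inv0 : 0 <= n.+1%:R^-1 :> R by rewrite invr_ge0.
  case/orP: sE => /eqP sE.
    have := FA x (e n + x); rewrite /e sE !mul1r lerDr => /(_ inv0).
    by rewrite ler_norml => /andP[+ _]; lra.
  have := FA (e n + x) x; rewrite /e sE !mulN1r gerDr oppr_le0 => /(_ inv0).
  by rewrite ler_norml => /andP[_]; lra.
have cu n : continuous (u n).
  move=> x; apply: cvgD; first exact: continuous_difference_quotient.
  by apply: cvgM; [exact: cvg_cst|exact: continuous_difference_quotient].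
have mu_ n : measurable_fun `[c, d] (EFin \o u n).
  apply/measurable_EFinP/measurable_funTS.
  exact: continuous_measurable_fun.
exists (fun x => limn_einf (fun n => (u n x)%:E)); split.
- rewrite /limn_einf; apply: measurableT_comp => //.
  apply: measurable_fun_limn_esup => n.
  by have := measurableT_comp (@oppe_measurable R setT) (mu_ n); apply.
- move=> x; apply: (@cvg_le_limn_einf _ _ (cst 0%E)); first exact: cvg_cst.
  by move=> n; rewrite lee_fin.
- have int_u : (\int[mu]_(x in `[c, d]) (u n x)%:E)%E @[n --> \oo] -->
      (A d - A c + s * (F d - F c))%:E.
    have icont f : continuous f -> mu.-integrable `[c, d] (EFin \o f).
      move=> cf; apply: continuous_compact_integrable.
        exact: segment_compact.
      exact: continuous_subspaceT.
    have idA n := icont _ (@continuous_difference_quotient _ _ (e n) cA).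
    have idF n := icont _ (@continuous_difference_quotient _ _ (e n) cF).
    apply: cvg_EFin.
      by apply: nearW => n; apply: integrable_fin_num => //; exact: icont.
    have lim_u : \int[mu]_(x in `[c, d]) difference_quotient A (e n) x +
        s * \int[mu]_(x in `[c, d]) difference_quotient F (e n) x
        @[n --> \oo] --> A d - A c + s * (F d - F c).
      apply: cvgD; first exact: cvg_integral_difference_quotient.
      by apply: cvgM; [exact: cvg_cst|exact: cvg_integral_difference_quotient].
    apply: cvg_trans lim_u; apply: near_eq_cvg; apply: nearW => n /=.
    rewrite -RintegralZl// -RintegralD//.
    exact: (@integrableZl _ _ _ mu _ _ s _ (idF n)).
  rewrite -(cvg_limn_einf_sup int_u).1.
  apply: fatou => //.
  by move=> n x _; rewrite lee_fin.
- move: dA dF; apply: filterS2; first exact: (ae_filter_ringOfSetsType mu).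
  move=> x dA dF xcd.
  have [psi [dpsi psix psiF]] := dF xcd.
  have dAn := cvg_difference_quotient e0 en0 dA.
  have dpsin := cvg_difference_quotient e0 en0 dpsi.
  apply: (@cvg_le_limn_einf _ _ (fun n => (difference_quotient A (e n) x +
      s * difference_quotient psi (e n) x)%:E)).
    apply: cvg_EFin; first exact: nearW.
    by apply: cvgD => //; apply: cvgM => //; exact: cvg_cst.
  (* [s / e n] is the positive number [n.+1] for either sign, so [psi <= F] with equality at [x]
     passes to the quotients multiplied by [s]. *)
  move=> n; rewrite lee_fin lerD2l /difference_quotient !mulrA seV.
  by rewrite ler_pM2l// psix lerD2r.
Qed.

(** Almost everywhere [U >= g + P] and [V >= g - P], while the integrals of [U] and [V] add up to at
    most twice that of [g]. Both inequalities are therefore equalities almost everywhere, and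
    [U - g] is an integrable representative of [P]. *)
Lemma Rintegral_support_derivative (R : realType) (F A g P : R -> R) (c d : R) :
  let mu := @lebesgue_measure R in
  c < d -> continuous A ->
  (forall x y, x <= y -> `|F y - F x| <= A y - A x) ->
  {ae mu, forall x : R, is_derive x 1 A (g x)} ->
  mu.-integrable `[c, d] (EFin \o g) ->
  \int[mu]_(x in `[c, d]) g x = A d - A c ->
  {ae mu, forall x : R, `[c, d]%classic x -> exists psi : R -> R,
    [/\ is_derive x 1 psi (P x), psi x = F x & forall y, psi y <= F y]} ->
  \int[mu]_(x in `[c, d]) P x = F d - F c.
Proof.
move=> mu cd cA FA dA ig gA dF.
have cF : continuous F.
  move=> x; apply/cvgrPdist_lt => eps eps0.
  have /cvgrPdist_lt /(_ _ eps0) := cA x; apply: filterS => y.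
  apply: le_lt_trans; case: (leP x y) => [|/ltW] xy.
    by rewrite distrC (le_trans (FA _ _ xy))// -normrN opprB ler_norm.
  by rewrite (le_trans (FA _ _ xy))// ler_norm.
have [|U [mU U0 intU gPU]] :=
  @fatou_difference_quotient _ _ _ _ _ _ _ 1 _ cd cA cF FA dA dF.
  by rewrite expr1n.
have [|V [mV V0 intV gPV]] :=
  @fatou_difference_quotient _ _ _ _ _ _ _ (-1) _ cd cA cF FA dA dF.
  by rewrite sqrrN expr1n.
rewrite mul1r in intU; rewrite mulN1r in intV.
set D := `[c, d]%classic in mU mV intU intV gPU gPV ig gA *.
have mD : measurable D by exact: measurable_itv.
have integrable_of (W : R -> \bar R) (r : R) : measurable_fun D W ->
    (forall x, 0 <= W x)%E -> (\int[mu]_(x in D) W x <= r%:E)%E ->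
    mu.-integrable D W.
  move=> mW W0 Wr; apply/integrableP; split => //.
  under eq_integral do rewrite gee0_abs//.
  exact: le_lt_trans Wr (ltry _).
have iU := integrable_of _ _ mU U0 intU.
have iV := integrable_of _ _ mV V0 intV.
have gE : (\int[mu]_(x in D) (g x)%:E = (A d - A c)%:E)%E.
  by rewrite -gA fineK//; exact: integrable_fin_num.
(* [W >= 0] almost everywhere while its integral is at most [0], hence
   [U = g + P] and [V = g - P] almost everywhere. *)
pose W x := ((U x - (g x)%:E) + (V x - (g x)%:E))%E.
have iUg := @integrableB _ _ _ mu D mD _ _ iU ig.
have iVg := @integrableB _ _ _ mu D mD _ _ iV ig.
have iW : mu.-integrable D W := @integrableD _ _ _ mu D mD _ _ iUg iVg.
have mW : measurable_fun D W := measurable_int mu iW.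
have [a Ua] : exists a, (\int[mu]_(x in D) U x = a%:E)%E.
  exists (fine (\int[mu]_(x in D) U x)); rewrite fineK//.
  exact: integrable_fin_num.
have [b Vb] : exists b, (\int[mu]_(x in D) V x = b%:E)%E.
  exists (fine (\int[mu]_(x in D) V x)); rewrite fineK//.
  exact: integrable_fin_num.
have intW :
    (\int[mu]_(x in D) W x = (a - (A d - A c) + (b - (A d - A c)))%:E)%E.
  rewrite integralD// integralB// integralB//.
  by rewrite gE Ua Vb -!EFinB -EFinD.
have absW : (\int[mu]_(x in D) `|W x| = \int[mu]_(x in D) W x)%E.
  apply: ae_eq_integral => //; first exact: measurableT_comp.
  move: gPU gPV; apply: filterS2; first exact: (ae_filter_ringOfSetsType mu).
  move=> x gPU gPV Dx; apply: gee0_abs.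
  have := gPU Dx; have := gPV Dx; rewrite /W/=.
  have := U0 x; have := V0 x.
  case: (U x) => [u||]//; case: (V x) => [v||]// _ _.
  rewrite -!EFinB -!EFinD !lee_fin => vP uP.
  by lra.
have absW_ge0 : (0 <= \int[mu]_(x in D) `|W x|)%E by apply: integral_ge0.
rewrite Ua lee_fin in intU; rewrite Vb lee_fin in intV.
have W0 : ae_eq mu D W (cst 0%E).
  apply/ae_eq_integral_abs => //; apply/eqP; rewrite eq_le absW_ge0 andbT.
  by rewrite absW intW lee_fin; lra.
have PE : ae_eq mu D (EFin \o P) (fun x => U x - (g x)%:E)%E.
  move: gPU gPV W0; apply: filterS3; first exact: (ae_filter_ringOfSetsType mu).
  move=> x gPU gPV W0 Dx.
  have := gPU Dx; have := gPV Dx; have := W0 Dx; rewrite /W/=.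
  have := U0 x; have := V0 x.
  (* An infinite value of [U] or [V] at [x] would contradict [W x = 0]. *)
  case: (U x) => [u||]//; case: (V x) => [v||]// _ _.
  rewrite -!EFinB -!EFinD !lee_fin => -[W0E] vP uP; congr EFin.
  by lra.
rewrite /Rintegral (ae_eq_integral_nonmeas _ _ PE)//; last first.
  exact: measurable_int iUg.
rewrite integralB// gE Ua -EFinB/=.
(* The bound [a + b >= 2 * (A d - A c)] forces equality in the upper bounds on [a] and [b]. *)
by move: absW_ge0; rewrite absW intW lee_fin; lra.
Qed.

(** * Primitives on half-lines and integrability of inputs *)

Lemma Rintegral_Nyc_diff (R : realType) (g : R -> R) (x y : R) :
  let mu := @lebesgue_measure R in
  mu.-integrable setT (EFin \o g) -> x <= y ->
  \int[mu]_(t in `]-oo, y]) g t - \int[mu]_(t in `]-oo, x]) g t =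
  \int[mu]_(t in `[x, y]) g t.
Proof.
move=> mu ig xy; rewrite Rintegral_itvB//; last 1 first.
  exact: integrableS ig.
by apply: Rintegral_itv_obnd_cbnd; exact: integrableS ig.
Qed.

(** Near [x] this primitive differs by a constant from the one starting at [x - 1], whose continuity
    on a segment is known. *)
Lemma continuous_Rintegral_Nyc (R : realType) (g : R -> R) :
  let mu := @lebesgue_measure R in
  mu.-integrable setT (EFin \o g) ->
  continuous (fun x => \int[mu]_(t in `]-oo, x]) g t).
Proof.
move=> mu ig x.
have xB : x - 1 < x by rewrite ltrBlDr ltrDl.
have xD : x < x + 1 by rewrite ltrDl.
have ab : x - 1 < x + 1 by exact: lt_trans xD.
have iab : mu.-integrable `[x - 1, x + 1] (EFin \o g) by exact: integrableS ig.
have /(continuous_within_itvP _ ab)[+ _ _] :=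
  parameterized_integral_continuous (ltW ab) iab.
move=> /(_ x); rewrite in_itv/= xB xD => /(_ isT) cx.
pose I y := parameterized_integral mu (x - 1) y g +
  \int[mu]_(t in `]-oo, x - 1]) g t.
have : I y @[y --> x] --> I x.
  by apply: cvgD; [exact: cx|exact: cvg_cst].
have -> : I x = \int[mu]_(t in `]-oo, x]) g t.
  by rewrite /I /parameterized_integral -Rintegral_Nyc_diff ?subrK// ltW.
apply: cvg_trans; apply: near_eq_cvg; near=> y.
rewrite /I /parameterized_integral -Rintegral_Nyc_diff ?subrK//.
by near: y; exact: lt_le_nbhsr.
Unshelve. all: by end_near. Qed.

Lemma ae_is_derive_Rintegral_Nyc (R : realType) (g : R -> R) :
  let mu := @lebesgue_measure R in
  mu.-integrable setT (EFin \o g) ->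
  {ae mu, forall x : R,
    is_derive x 1 (fun x => \int[mu]_(t in `]-oo, x]) g t) (g x)}.
Proof.
move=> mu ig; have iy y : mu.-integrable `]-oo, y] (EFin \o g).
  exact: integrableS ig.
have := FTC1Ny iy (open_integrable_locally openT ig).
apply: filterS; first exact: (ae_filter_ringOfSetsType mu).
by move=> x [dg gE]; apply: DeriveDef => //; rewrite -derive1E.
Qed.

Lemma Rintegral_sum d (T : measurableType d) (R : realType)
    (mu : {measure set T -> \bar R}) (D : set T) (n : nat)
    (f : 'I_n -> T -> R) :
  measurable D -> (forall j, mu.-integrable D (EFin \o f j)) ->
  \int[mu]_(x in D) (\sum_(j < n) f j x) = \sum_(j < n) \int[mu]_(x in D) f j x.
Proof.
move=> mD fi; rewrite /Rintegral.
under eq_integral do rewrite -sumEFin.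
rewrite sum_fine => [|j _]; last by apply: integrable_fin_num => //; exact: fi.
by rewrite integral_sum.
Qed.

Lemma integrable_sum_norm d (T : measurableType d) (R : realType)
    (mu : {measure set T -> \bar R}) (D : set T) (n : nat)
    (f : 'I_n -> T -> R) :
  measurable D -> (forall j, mu.-integrable D (EFin \o f j)) ->
  mu.-integrable D (EFin \o (fun x => \sum_(j < n) `|f j x|)).
Proof.
move=> mD fi.
rewrite (_ : _ \o _ = fun x => (\sum_(j < n) `|f j x|%:E)%E); last first.
  by apply/funext => x; rewrite /= sumEFin.
apply: integrable_sum => // j _.
exact: (integrable_norm (fi j)).
Qed.

(** On a bounded interval [|p j|] is dominated by the integrable function [1 + p j ^+ 2]. *)
Lemma admissible_input_integrable (R : realType) (n : nat)
    (p : 'I_n -> R -> R) (j : 'I_n) (t : R) :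
  admissible_input p -> 0 <= t ->
  (@lebesgue_measure R).-integrable `[0, t] (EFin \o p j).
Proof.
move=> /(_ j t) + t0 => /(_ t0)[mp ip2].
have i1 : (@lebesgue_measure R).-integrable `[0, t] (EFin \o cst 1).
  apply: continuous_compact_integrable; first exact: segment_compact.
  by apply: continuous_subspaceT => x; exact: cvg_cst.
have i12 := @integrableD _ _ _ (@lebesgue_measure R) _ (measurable_itv _) _ _
  i1 ip2.
apply: le_integrable i12 => //; first exact/measurable_EFinP.
move=> x _; rewrite /= lee_fin.
rewrite [leRHS]ger0_norm ?addr_ge0 ?sqr_ge0//.
rewrite -real_normK ?num_real//; have := sqr_ge0 (`|p j x| - 1).
by have := normr_ge0 (p j x); nra.
Qed.

(** * Chain rule for a subgradient selection along the state *)

(** The bound on [G] makes [L] 1-Lipschitz for the l1 norm, so [L] along the state is dominated by a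
    primitive of the l1 norm of the input; the subgradient inequality provides the supports from
    below. *)
Lemma subgradient_chain_rule (R : realType) (n : nat) (L : vec R n -> R)
    (G : vec R n -> vec R n) (q0 : vec R n) (p : 'I_n -> R -> R) (t : R) :
  (forall q q', L q + dotp (fun j => q' j - q j) (G q) <= L q') ->
  (forall q j, `|G q j| <= 1) ->
  admissible_input p -> 0 <= t ->
  L (state q0 p t) = L q0 + Rintegral lebesgue_measure `[0, t]
    (fun s => \sum_(j < n) p j s * G (state q0 p s) j).
Proof.
move=> LG G1 ap; rewrite le_eqVlt => /predU1P[<-|t0].
  have -> : state q0 p 0 = q0.
    by apply/funext => j; rewrite /state set_itv1 Rintegral_set1 addr0.
  by rewrite set_itv1 Rintegral_set1 addr0.
set mu := @lebesgue_measure R.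
(* Extension by zero makes the input integrable on the whole line, so [Q] is defined everywhere and
   agrees with the state on [[0, t]]. *)
pose pt j := p j \_ `[0, t + 1].
have ipt j : mu.-integrable setT (EFin \o pt j).
  rewrite /pt -restrict_EFin -integrable_mkcond//.
  by apply: admissible_input_integrable => //; rewrite addr_ge0// ltW.
pose Q x : vec R n := fun j => q0 j + \int[mu]_(s in `]-oo, x]) pt j s.
have QE x : 0 <= x <= t -> Q x = state q0 p x.
  move=> /andP[x0 xt]; apply/funext => j; rewrite /Q /state; congr (_ + _).
  rewrite /pt -Rintegral_mkcondr; congr (Rintegral _ _ _).
  apply/seteqP; split=> s /=; rewrite !in_itv/=.
    by move=> [sx /andP[-> _]].
  move=> /andP[-> sx]; split => //.
  by rewrite (le_trans sx)// (le_trans xt)// lerDl.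
pose g x := \sum_(j < n) `|pt j x|.
have ig : mu.-integrable setT (EFin \o g).
  exact: integrable_sum_norm.
pose A x := \int[mu]_(s in `]-oo, x]) g s.
pose F x := L (Q x).
have QB x y j : x <= y -> Q y j - Q x j = \int[mu]_(s in `[x, y]) pt j s.
  by move=> xy; rewrite /Q opprD addrACA subrr add0r Rintegral_Nyc_diff.
have FA x y : x <= y -> `|F y - F x| <= A y - A x.
  move=> xy.
  have QA : \sum_(j < n) `|Q y j - Q x j| <= A y - A x.
    rewrite /A Rintegral_Nyc_diff// /g Rintegral_sum//; last first.
      move=> j; apply: integrable_norm; exact: integrableS (ipt j).
    apply: ler_sum => j _; rewrite QB//; apply: le_normr_Rintegral => //.
    exact: integrableS (ipt j).
  apply: le_trans QA.
  have dotp1 u q : `|dotp u (G q)| <= \sum_(j < n) `|u j|.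
    apply: le_trans (ler_norm_sum _ _ _) _; apply: ler_sum => j _.
    by rewrite normrM ler_piMr.
  (* The subgradient inequalities at [Q x] and at [Q y] bound [F y - F x] from below and from
     above. *)
  have := LG (Q x) (Q y); have := LG (Q y) (Q x).
  have := dotp1 (fun j => Q y j - Q x j) (Q x).
  have := dotp1 (fun j => Q x j - Q y j) (Q y).
  under eq_bigr do rewrite distrC.
  rewrite -/(F x) -/(F y) !ler_norml => /andP[a1 a2] /andP[a3 a4] a5 a6.
  by apply/andP; split; lra.
have int_g : \int[mu]_(x in `[0, t]) g x = A t - A 0.
  by rewrite /A Rintegral_Nyc_diff// ltW.
have ig0 : mu.-integrable `[0, t] (EFin \o g) by exact: integrableS ig.
pose P s := \sum_(j < n) p j s * G (state q0 p s) j.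
have dF : {ae mu, forall x : R, `[0, t]%classic x -> exists psi : R -> R,
    [/\ is_derive x 1 psi (P x), psi x = F x & forall y, psi y <= F y]}.
  have : {ae mu, forall x, forall j, is_derive (x : R) 1
      (fun x => \int[mu]_(s in `]-oo, x]) pt j s) (pt j x)}.
    (* Finitely many coordinates share one exceptional null set. *)
    apply: (@filter_forall _ _ _ _ (ae_filter_ringOfSetsType mu)) => j.
    exact: ae_is_derive_Rintegral_Nyc.
  apply: filterS; first exact: (ae_filter_ringOfSetsType mu).
  move=> x dx /=; rewrite in_itv/= => /[dup] x0t /andP[x0 xt].
  (* [G] is frozen at [Q x], so the support is differentiable at [x] as soon as the coordinates of
     [Q] are. *)
  exists (fun y => F x + \sum_(j < n) (Q y j - Q x j) * G (Q x) j); split.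
  - have dh j : is_derive x 1 (fun y => (Q y j - Q x j) * G (Q x) j)
        (p j x * G (state q0 p x) j).
      have pE : pt j x = p j x.
        by rewrite /pt patchE mem_set//= in_itv/= x0 (le_trans xt)// lerDl.
      have := is_deriveZ (G (Q x) j)
        (is_deriveB (is_deriveD (is_derive_cst (q0 j) x 1) (dx j))
          (is_derive_cst (Q x j) x 1)).
      rewrite add0r subr0 pE QE// [_ *: _]mulrC.
      congr is_derive; apply/funext => y /=.
      by rewrite [_ * G _ _]mulrC.
    have := is_deriveD (is_derive_cst (F x) x 1) (is_derive_sum dh).
    rewrite add0r; congr is_derive; apply/funext => y /=.
    by rewrite fct_sumE.
  - rewrite big1 ?addr0// => j _.
    by rewrite subrr mul0r.
  - move=> y; exact: LG.
have := Rintegral_support_derivative t0 (continuous_Rintegral_Nyc ig) FA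
  (ae_is_derive_Rintegral_Nyc ig) ig0 int_g dF.
rewrite /P => ->; rewrite /F !QE ?lexx ?ltW//.
have -> : state q0 p 0 = q0.
  by apply/funext => j; rewrite /state set_itv1 Rintegral_set1 addr0.
by rewrite subrKC.
Qed.

(** * Convex conjugate and storage function *)

(** The maximizer [f q] makes the set of values nonempty and bounded above, so [sup] is not a
    default value. *)
Lemma hstarE (R : realType) (n : nat) (h : vec R n -> R)
    (f : vec R n -> vec R n) (q : vec R n) :
  is_ftrl_conversion h f -> hstar h q = dotp q (f q) - h (f q).
Proof.
move=> hf; have [fq fmax] := hf q.
have ub : ubound [set dotp q x - h x | x in @in_simplex R n]
    (dotp q (f q) - h (f q)).
  by move=> _ [x /fmax + <-].
apply/eqP; rewrite eq_le; apply/andP; split.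
  by apply: ge_sup => //; exists (dotp q (f q) - h (f q)), (f q).
apply: ub_le_sup; last by exists (f q).
by exists (dotp q (f q) - h (f q)).
Qed.

Lemma fenchel_young (R : realType) (n : nat) (h : vec R n -> R)
    (f : vec R n -> vec R n) (q x : vec R n) :
  is_ftrl_conversion h f -> in_simplex x -> dotp q x - h x <= hstar h q.
Proof. by move=> hf sx; rewrite (hstarE q hf); exact: (hf q).2. Qed.

(** This is Fenchel-Young for [q'] at the point [f q], which attains [hstar h q]. *)
Lemma hstar_subgradient (R : realType) (n : nat) (h : vec R n -> R)
    (f : vec R n -> vec R n) (q q' : vec R n) :
  is_ftrl_conversion h f ->
  hstar h q + dotp (fun j => q' j - q j) (f q) <= hstar h q'.
Proof.
move=> hf; apply: le_trans (fenchel_young q' hf (hf q).1).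
rewrite (hstarE q hf) addrAC lerD2r.
by rewrite /dotp -big_split/=; under eq_bigr do rewrite -mulrDl subrKC.
Qed.

(** The chain rule applies with [G q = f q - xs]: coordinates of simplex points lie in [[0, 1]], so
    their differences are at most 1 in absolute value. *)
Lemma ftrl_finitely_lossless (R : realType) (n : nat) (h : vec R n -> R)
    (f : vec R n -> vec R n) (xs : vec R n) :
  is_ftrl_conversion h f -> in_simplex xs ->
  finitely_lossless_via f xs (fun q => hstar h q - dotp q xs + h xs).
Proof.
move=> hf sxs; split.
  by exists 0 => q; have := fenchel_young q hf sxs; lra.
have le1 (x : vec R n) j : in_simplex x -> x j <= 1.
  move=> [x0 <-]; rewrite (bigD1 j)//= lerDl.
  by apply: sumr_ge0 => i _.
move=> q0 p ap t t0.
apply: (@subgradient_chain_rule _ _ (fun q => hstar h q - dotp q xs + h xs)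
  (fun q j => f q j - xs j)) => // q.
- move=> q'; have := hstar_subgradient q q' hf.
  have -> : dotp (fun j => q' j - q j) (fun j => f q j - xs j) =
      dotp (fun j => q' j - q j) (f q) - (dotp q' xs - dotp q xs).
    by rewrite /dotp -!sumrB; apply: eq_bigr => j _; ring.
  by lra.
- move=> j; have [sf _] := hf q.
  have := sf.1 j; have := sxs.1 j; have := le1 _ j sf; have := le1 _ j sxs.
  by rewrite ler_norml => *; apply/andP; split; lra.
Qed.

Lemma basis_vec_in_simplex (R : realType) (n : nat) (j : 'I_n) :
  in_simplex (basis_vec R j).
Proof.
split=> [i|]; first exact: ler0n.
by rewrite (bigD1 j)//= /basis_vec eqxx big1 ?addr0// => i /negbTE ->.
Qed.

Theorem theorem4p1 (R : realType) (n : nat) (h : vec R n -> R)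
  (hconv : strictly_convex_on_simplex h)
  (f : vec R n -> vec R n) (hf : is_ftrl_conversion h f) :
  (forall xs : vec R n, in_simplex xs ->
     finitely_lossless_via f xs
       (fun q => hstar h q - dotp q xs + h xs))
  /\ finitely_lossless_dynamic f.
Proof.
split=> [xs|j]; first exact: ftrl_finitely_lossless.
by eexists; apply: (ftrl_finitely_lossless hf); exact: basis_vec_in_simplex.
Qed.
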